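(* Let $n$ be a positive integer and $p_1,\dots,p_n$ distinct primes. Let $(X,r)$ be an indecomposable multipermutation solution of the YBE with $|X|=p_1\cdots p_n$, and let $P_i$ be the Sylow $p_i$-subgroup of the additive group of the left brace $\mathcal G(X,r)$, $i=1,\dots,n$. Then: (i) $\mathrm{soc}(\mathcal G(X,r))$ is a Hall $\pi$-subgroup of the additive group of $\mathcal G(X,r)$ for some non-empty subset $\pi\subseteq\{p_1,\dots,p_n\}$; (ii) $\mathcal G(X,r)=P_1P_2\cdots P_n$ (product in the multiplicative group); in particular $p_1,\dots,p_n$ are the only primes dividing $|\mathcal G(X,r)|$; (iii) each $P_i$ is a trivial brace whose additive group is an elementary abelian $p_i$-group; (iv) there is a permutation $\sigma\in\mathrm{Sym}_n$ such that $P_{\sigma(1)},\ P_{\sigma(1)}P_{\sigma(2)},\ \dots,\ P_{\sigma(1)}P_{\sigma(2)}\cdots P_{\sigma(n)}$ are ideals of the left brace $\mathcal G(X,r)$, $P_{\sigma(1)}\subseteq \mathrm{soc}(\mathcal G(X,r))$, and for every $1<i\le n$, $$(P_{\sigma(1)}\cdots P_{\sigma(i)})/(P_{\sigma(1)}\cdots P_{\sigma(i-1)})\subseteq \mathrm{soc}\big(\mathcal G(X,r)/(P_{\sigma(1)}\cdots P_{\sigma(i-1)})\big);$$ (v) for $1\le i\le n$, letting $K_i=\{g\in\mathcal G(X,r): g(P_{\sigma(1)}\cdots P_{\sigma(i)}(x))=P_{\sigma(1)}\cdots P_{\sigma(i)}(x)\text{ for all }x\in X\}$, where $H(x)=\{h(x):h\in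 H\}$, one has $K_i=P_{\sigma(1)}\cdots P_{\sigma(i)}$.
   Context: A solution of the Yang–Baxter equation (YBE) is a pair $(X,r)$, where $X$ is a non-empty set and $r\colon X\times X\to X\times X$, written $r(x,y)=(\sigma_x(y),\gamma_y(x))$, satisfies: $r^2=\mathrm{id}$; all maps $\sigma_x,\gamma_y$ are bijections of $X$; and $r_{12}r_{23}r_{12}=r_{23}r_{12}r_{23}$ on $X^3$, where $r_{12}=r\times\mathrm{id}_X$, $r_{23}=\mathrm{id}_X\times r$. $\mathcal G(X,r)=\langle\sigma_x:x\in X\rangle\le\mathrm{Sym}_X$; $(X,r)$ is indecomposable if $\mathcal G(X,r)$ is transitive on $X$. Retract: $x\sim y\iff\sigma_x=\sigma_y$, inducing a solution $\mathrm{Ret}(X,r)$ on $X/{\sim}$; $(X,r)$ is multipermutation if the iterated retract $\mathrm{Ret}^k(X,r)$ has one element for some $k\ge1$ (least such $k$ = multipermutation level). A left brace is a set $B$ with operations $+$ and $\circ$ (written $ab=a\circ b$) such that $(B,+)$ is an abelian group, $(B,\circ)$ is a group, and $a(b+c)+a=ab+ac$ for all $a,b,c$. Then $\lambda_a(b)=-a+ab$ defines a homomorphism $\lambda\colon(B,\circ)\to\mathrm{Aut}(B,+)$. $B$ is trivial if $ab=a+b$ for all $a,b$. The socle is $\mathrm{soc}(B)=\{a\in B: ab=a+b\ \forall b\in B\}=\ker\lambda$. A left ideal is an additive subgroup $L$ with $\lambda_a(L)\subseteq L$ for all $a\in B$; an ideal is a normal subgroup $I$ of $(B,\circ)$ with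 $\lambda_a(I)\subseteq I$ for all $a$ (ideals are additive subgroups and $B/I$ is a left brace). Sylow subgroups of $(B,+)$ of a finite left brace are left ideals, hence also subgroups of $(B,\circ)$. Brace structure on $\mathcal G(X,r)$: the structure group $G(X,r)=\langle x\in X\mid xy=\sigma_x(y)\gamma_y(x)\ \forall x,y\rangle$ is a left brace with additive group free abelian on $X$ and $\lambda_x(y)=\sigma_x(y)$; the map $x\mapsto\sigma_x$ extends to a group epimorphism $\phi\colon G(X,r)\to\mathcal G(X,r)$ with kernel $\mathrm{soc}(G(X,r))$, and $\mathcal G(X,r)$ is given the unique left brace structure (with its composition as multiplication) making $\phi$ a homomorphism of left braces. It satisfies $\lambda_g(\sigma_y)=\sigma_{g(y)}$ for all $g\in\mathcal G(X,r)$, $y\in X$. *)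

(* Defs.v *)
From HB Require Import structures.
From mathcomp Require Import all_boot all_order all_algebra all_fingroup.
Set Implicit Arguments. Unset Strict Implicit. Unset Printing Implicit Defensive.
Import GRing.Theory.

Section YBE.
Variable X : finType.

(* A map r(x,y) = (sig x y, gam y x); bijectivity of sig x, gam y is built in
   by taking them as permutations. *)
Definition rmap (sig gam : X -> {perm X}) (t : X * X) : X * X :=
  (sig t.1 t.2, gam t.2 t.1).

Definition r12 sig gam (t : X * X * X) : X * X * X :=
  let: (x, y, z) := t in let: (u, v) := rmap sig gam (x, y) in (u, v, z).
Definition r23 sig gam (t : X * X * X) : X * X * X :=
  let: (x, y, z) := t in let: (u, v) := rmap sig gam (y, z) in (x, u, v).

Definition is_solution (sig gam : X -> {perm X}) : Prop :=
  (forall t, rmap sig gam (rmap sig gam t) = t) /\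
  (forall t, r12 sig gam (r23 sig gam (r12 sig gam t))
             = r23 sig gam (r12 sig gam (r23 sig gam t))).

Definition Gsol (sig : X -> {perm X}) : {set {perm X}} :=
  <<[set sig x | x : X]>>%g.

Definition indecomposable (sig : X -> {perm X}) : Prop :=
  forall x y, exists2 g, g \in Gsol sig & g x = y.

(* x ~_k y iff x and y have the same image in Ret^k(X,r) (pulled back to X). *)
Fixpoint ret_rel (sig : X -> {perm X}) (k : nat) : rel X :=
  match k with
  | 0 => fun x y => x == y
  | k'.+1 => fun x y => [forall z, ret_rel sig k' (sig x z) (sig y z)]
  end.

Definition multipermutation (sig : X -> {perm X}) : Prop :=
  exists k, (0 < k)%N /\ forall x y, ret_rel sig k x y.

(* Composition a o b (apply b first) in Sym_X; mathcomp's (b * a) applies b first. *)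
Definition bcomp (a b : {perm X}) : {perm X} := (b * a)%g.

Definition delta (x : X) : {ffun X -> int} := [ffun z => Posz (z == x)].
Definition pact (g : {perm X}) (b : {ffun X -> int}) : {ffun X -> int} :=
  [ffun z => b ((g^-1)%g z)].

(* add is the addition of the left brace G(X,r): (G, add, bcomp) is a left brace
   and phi : G(X,r) -> G(X,r) (structure group, realised as Z^X with product
   a o b = a + lambda_a(b), lambda_a permuting the basis by phi(a)) is a brace
   homomorphism with phi(e_x) = sigma_x. *)
Definition is_Gbrace (sig : X -> {perm X}) (add : {perm X} -> {perm X} -> {perm X}) : Prop :=
  let G := Gsol sig in
  [/\ [/\ {in G &, forall a b, add a b \in G},
      {in G & &, forall a b c, add (add a b) c = add a (add b c)},
      {in G &, forall a b, add a b = add b a},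
      {in G, forall a, add 1%g a = a} &
      {in G, forall a, exists2 b, b \in G & add a b = 1%g}],
      {in G & &, forall a b c, add (bcomp a (add b c)) a = add (bcomp a b) (bcomp a c)} &
      exists f : {ffun X -> int} -> {perm X},
        [/\ forall a, f a \in G,
            forall a b, f (a + b)%R = add (f a) (f b),
            forall x, f (delta x) = sig x &
            forall a b, f (a + pact (f a) b)%R = bcomp (f a) (f b)]].

Definition nadd (add : {perm X} -> {perm X} -> {perm X}) (k : nat) (g : {perm X}) :=
  iter k (add g) 1%g.

Definition is_add_subgroup (sig : X -> {perm X}) add (H : {set {perm X}}) : Prop :=
  [/\ H \subset Gsol sig, 1%g \in H & {in H &, forall a b, add a b \in H}].

Definition is_add_sylow sig add (p : nat) (H : {set {perm X}}) : Prop :=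
  is_add_subgroup sig add H /\ #|H| = (#|Gsol sig|`_p)%N.

Definition socle sig add : {set {perm X}} :=
  [set a in Gsol sig | [forall b in Gsol sig, bcomp a b == add a b]].

Definition setcomp (A B : {set {perm X}}) : {set {perm X}} :=
  [set bcomp a b | a in A, b in B].

Definition is_ideal sig add (I : {set {perm X}}) : Prop :=
  let G := Gsol sig in
  [/\ I \subset G, 1%g \in I,
      {in I &, forall a b, bcomp a b \in I},
      {in I, forall a, (a^-1)%g \in I} &
      {in G & I, forall g a, bcomp (bcomp g a) (g^-1)%g \in I} /\
       {in G & I, forall g a, exists2 c, c \in I & add g c = bcomp g a}].

Definition same_class (I : {set {perm X}}) (x y : {perm X}) : bool :=
  bcomp (x^-1)%g y \in I.

Definition hset (H : {set {perm X}}) (x : X) : {set X} := [set (h : {perm X}) x | h in H].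

End YBE.

Definition Qprod (X : finType) (n : nat) (P : 'I_n -> {set {perm X}}) (s : 'S_n) (i : nat)
  : {set {perm X}} :=
  \big[@setcomp X/[set 1%g]]_(j < n | (j < i)%N) P (s j).

Definition primes_of_idx (n : nat) (p : 'I_n -> nat) (S : {set 'I_n}) : nat_pred :=
  [pred q | [exists i in S, q == p i]].

(* Main.v *)
(* Let N_k be the kernel of the action of G = G(X,r) on Ret^k(X,r) and H_k the
   stabilizer of the class of a point in Ret^k(X,r). The N_k form the socle series
   of the brace G. As N_(k+1)/N_k is abelian and N_(k+1) H_k is a subgroup of
   H_(k+1), the exponent of N_(k+1)/N_k divides |H_(k+1) : H_k|. These indices
   multiply up to |X|, which is squarefree, so every N_k is a normal Hall subgroup
   of G and each prime p_i divides exactly one factor |N_(k+1) : N_k|; call k the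
   level of p_i. Then P_i embeds in N_(k+1)/N_k, whence (iii). Ordering the primes by
   level yields N_k <= P_s(1)...P_s(i-1) <= P_s(1)...P_s(i) <= N_(k+1) with k the
   level of p_s(i), and the remaining claims follow because N_(k+1)/N_k is an
   abelian normal subgroup contained in the socle of G/N_k. *)
Require Import Defs.
From HB Require Import structures.
From mathcomp Require Import all_boot all_order all_algebra all_fingroup all_solvable.
Set Implicit Arguments. Unset Strict Implicit. Unset Printing Implicit Defensive.
Import GRing.Theory.

(** * Chains of cores in a finite group *)

(* Applied with H k the stabilizer in G of the ~_k-class of a point x0 of X, and
   N k the kernel of the action of G on Ret^k(X,r), i.e. the core of H k. *)
Section Chain.
Variables (gT : finGroupType) (G : {group gT}) (H N : nat -> {group gT}) (K : nat).
Local Open Scope group_scope.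
Hypotheses (sHS : forall k, H k \subset H k.+1)
  (sHG : forall k, H k \subset G) (nNG : forall k, N k <| G)
  (sNH : forall k, N k \subset H k) (sNS : forall k, N k \subset N k.+1)
  (N0 : N 0 = 1 :> {set gT})
  (NG : N K = G)
  (derN : forall k, (N k.+1)^`(1) \subset N k)
  (coreN : forall k a, a \in N k.+1 ->
     {in G, forall g, a ^ g \in H k} -> a \in N k)
  (coprimeGH0 : forall m n, (m * n)%N = #|G : H 0| -> coprime m n).

(** [T] contains the derived subgroup of [N k.+1], so it is normal there, and its index equals that
    of [H k] in the product of [H k] and [N k.+1], a divisor of |[H k.+1] : [H k]|. So this power
    sends every conjugate of [a] into [H k], and [coreN] applies. *)
Lemma expg_chain k a : a \in N k.+1 -> a ^+ #|H k.+1 : H k| \in N k.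
Proof.
move=> Na.
set T := N k.+1 :&: H k.
have nT : T <| N k.+1.
  by apply: sub_der1_normal; rewrite ?subsetIl // subsetI der_sub /= (subset_trans (derN k)).
have aT b : b \in N k.+1 -> b ^+ #|H k.+1 : H k| \in H k.
  move=> Nb.
  have nHN : H k \subset 'N(N k.+1).
    exact: subset_trans (sHG k) (normal_norm (nNG k.+1)).
  have <- : (#|H k.+1 : H k <*> N k.+1| * #|H k <*> N k.+1 : H k|)%N = #|H k.+1 : H k|.
    rewrite Lagrange_index ?joing_subl // join_subG sHS; exact: sNH.
  rewrite mulnC expgM groupX //.
  rewrite norm_joinEl // indexMg -indexgI.
  suff: b ^+ #|N k.+1 : T| \in T by case/setIP.
  have nb : b \in 'N(T) by apply: (subsetP (normal_norm nT)).
  apply: coset_idr; first by rewrite groupX.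
  by rewrite morphX // -card_quotient ?normal_norm // expg_cardG ?mem_quotient.
apply: coreN => [|g Gg]; first by rewrite groupX.
by rewrite conjXg aT // memJ_norm // (subsetP (normal_norm (nNG k.+1))).
Qed.

(** By [expg_chain] the exponent of the quotient divides |[H k.+1] : [H k]|, and the order of a
    finite group has the same primes as its exponent. *)
Lemma pi_indexN k : \pi(#|H k.+1 : H k|).-nat #|N k.+1 : N k|.
Proof.
have nN : N k <| N k.+1.
  exact: normalS (sNS k) (normal_sub (nNG k.+1)) (nNG k).
rewrite -[#|N k.+1 : _|]card_quotient ?normal_norm // -[_.-nat _]/(pgroup _ _).
rewrite -pnat_exponent.
have: exponent (N k.+1 / N k) %| #|H k.+1 : H k|.
  apply/exponentP => _ /morphimP[a na Na ->].
  by rewrite -morphX //= coset_id // expg_chain.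
by move/pnat_dvd; apply; rewrite pnat_pi // indexg_gt0.
Qed.

Lemma sH0 k : H 0 \subset H k.
Proof. by elim: k => // k IH; apply: subset_trans IH (sHS k). Qed.

Lemma mono_sN j k : (j <= k)%N -> N j \subset N k.
Proof.
elim: k => [|k IH]; first by rewrite leqn0 => /eqP->.
rewrite leq_eqVlt ltnS => /orP[/eqP-> //|/IH s]; exact: subset_trans s (sNS k).
Qed.

Lemma chain_group_pi k : \pi(#|H k : H 0|).-group (N k).
Proof.
elim: k => [|k IH]; first by rewrite /pgroup N0 cards1.
rewrite /pgroup -(Lagrange (sNS k)) pnatM; apply/andP; split.
  apply: sub_in_pnat IH => q _; apply: pi_of_dvd; last by rewrite indexg_gt0.
  by rewrite -(Lagrange_index (sHS k) (sH0 k)) dvdn_mull.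
apply: sub_in_pnat (pi_indexN k) => q _; apply: pi_of_dvd; last by rewrite indexg_gt0.
by rewrite -(Lagrange_index (sHS k) (sH0 k)) dvdn_mulr.
Qed.

(** Descending induction from [N K = G]: each step down contributes a factor |[N j.+1] : [N j]|,
    whose primes divide |[H j.+1] : [H j]|. *)
Lemma chain_index_pi k : (k <= K)%N -> \pi(#|G : H k|).-nat #|G : N k|.
Proof.
move=> /subKn <-; elim: (K - k)%N => [|m IH].
  by rewrite subn0 NG indexgg.
have [lt|] := ltnP m K; last first.
  (* Past [K] the truncated subtraction stays at 0. *)
  by move=> le; move: IH; have /eqP-> := le; have /eqP-> := leqW le.
have E : (K - m)%N = (K - m.+1).+1 by rewrite subnSK.
move: IH; rewrite E; set j := (K - m.+1)%N => IH.
rewrite -(Lagrange_index (normal_sub (nNG j.+1)) (sNS j)) pnatM; apply/andP; split.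
  apply: sub_in_pnat IH => q _; apply: pi_of_dvd; last by rewrite indexg_gt0.
  by rewrite -(Lagrange_index (sHG j.+1) (sHS j)) dvdn_mulr.
apply: sub_in_pnat (pi_indexN j) => q _; apply: pi_of_dvd; last by rewrite indexg_gt0.
by rewrite -(Lagrange_index (sHG j.+1) (sHS j)) dvdn_mull.
Qed.

(** The indices |[G] : [H k]| and |[H k] : [H 0]| multiply to |[G] : [H 0]|, so [coprimeGH0], which
    expresses squarefreeness, separates the primes of |[G] : [N k]| from those of |[N k]|. *)
Lemma chain_Hall k : (k <= K)%N -> \pi(#|H k : H 0|).-Hall(G) (N k).
Proof.
move=> lekK; rewrite pHallE normal_sub //= -(Lagrange (normal_sub (nNG k))).
rewrite partnM ?indexg_gt0 // part_pnat_id; last exact: chain_group_pi.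
rewrite part_p'nat ?muln1 //.
apply: sub_in_pnat (chain_index_pi lekK) => q _.
apply: (@pnatPpi (\pi(#|H k : H 0|)^') #|G : H k|).
rewrite -coprime_pi' ?indexg_gt0 //.
by apply: coprimeGH0; rewrite mulnC Lagrange_index ?sH0.
Qed.

(* The order of a divides the squarefree number #|H k.+1 : H k|. *)
Lemma order_chain k p a : prime p -> a \in N k.+1 -> p.-elt a ->
  <[a]> :&: N k = 1 -> #[a] %| p.
Proof.
move=> p_pr Na pa tia.
have dvh : #[a] %| #|H k.+1 : H k|.
  rewrite order_dvdn -in_set1 -[[set 1]]/(1 : {set gT}) -tia inE mem_cycle.
  exact: expg_chain.
have/p_natP[m Em] := pa; rewrite -/(order a) in Em.
case: m Em => [|[|m]] Em; rewrite Em ?dvd1n //.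
have : #[a] %| #|G : H 0|.
  apply: dvdn_trans dvh _.
  by rewrite -(Lagrange_index (sHG k.+1) (sH0 k.+1))
             -(Lagrange_index (sHS k) (sH0 k)) dvdn_mull // dvdn_mulr.
case/dvdnP=> c Ec.
have : coprime (c * p ^ m.+1) p.
  by apply: coprimeGH0; rewrite Ec Em -mulnA -expnSr.
rewrite coprimeMl coprime_pexpl // => /andP[_].
by rewrite prime_coprime // dvdnn.
Qed.
End Chain.

(** * Squarefree products and sorting of indices *)

Lemma coprime_of_mul_prod_primes n (p : 'I_n -> nat) a b :
  (forall i, prime (p i)) -> injective p ->
  a * b = \prod_(i < n) p i -> coprime a b.
Proof.
move=> p_pr p_inj Eab.
have pos : 0 < a * b by rewrite Eab prodn_gt0 // => i; apply: prime_gt0.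
have [a0 b0] : 0 < a /\ 0 < b by apply/andP; rewrite -muln_gt0.
rewrite coprime_has_primes //; apply/hasPn=> q.
rewrite !mem_primes => /and3P[q_pr _ qb]; apply/negP=> /and3P[_ _ qa].
have div_prod P : q %| \prod_(i < n | P i) p i -> exists2 i, P i & q = p i.
  rewrite Euclid_dvd_prod // big_orE => /existsP[i /andP[Pi]].
  by rewrite dvdn_prime2 // => /eqP; exists i.
(* The square of a common prime [q] would divide the product; cancelling [q = p i] leaves [q = p j]
   with [j] different from [i]. *)
have : q * q %| a * b by apply: dvdn_mul.
have [i _ Eq] : exists2 i, xpredT i & q = p i by apply: div_prod; rewrite -Eab dvdn_mulr.
rewrite Eab (bigD1 i) //= -Eq dvdn_pmul2l ?prime_gt0 //.
by case/div_prod=> j /eqP nj; rewrite Eq => /p_inj /esym.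
Qed.

(** Applied to [level], this supplies the permutation of (iv) and (v). *)
Lemma sorting_perm n (l : 'I_n -> nat) :
  exists t : 'S_n, forall i j : 'I_n, i <= j -> l (t i) <= l (t j).
Proof.
pose leT i j := l i <= l j.
have leTT : total leT by move=> i j; apply: leq_total.
have trT : transitive leT by move=> i j k; apply: leq_trans.
pose r := sort leT (enum 'I_n).
have sz : size r == n by rewrite size_sort size_enum_ord.
have inj : injective (tnth (Tuple sz)).
  by apply/tuple_uniqP; rewrite /= sort_uniq enum_uniq.
exists (perm inj) => i j le; rewrite !permE !(tnth_nth i).
apply: (sorted_leq_nth trT) => //; first by move=> k; apply: leqnn.
  exact: sort_sorted.
all: by rewrite inE (eqP sz).
Qed.

(** * Left braces acting on a solution *)

Section Brace.
Local Open Scope group_scope.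
Local Open Scope ring_scope.
(** The brace is given by its additive group [A] and its embedding [e] into the permutations of [X].
    Its product is a o b = a + lam a b, sent by [e] to composition, and [s x] stands for the element
    sigma_x. *)
Variables (X : finType) (A : finZmodType) (e : A -> {perm X}) (lam : A -> A -> A).
Variables (s : X -> A) (sig : X -> {perm X}).
Hypotheses (e_inj : injective e)
  (eM : forall a b, e (a + lam a b) = (e b * e a)%g)
  (lamD : forall a b c, lam a (b + c) = lam a b + lam a c)
  (e_s : forall x, e (s x) = sig x)
  (lam_s : forall a x, lam a (s x) = s (e a x))
  (s_gen : forall L : {set A}, 0 \in L -> {in L &, forall a b, a + b \in L} ->
     (forall x, s x \in L) -> forall a, a \in L).

Lemma lam0 a : lam a 0 = 0.
Proof. by apply: (addrI (lam a 0)); rewrite -lamD !addr0. Qed.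

Lemma lamN a b : lam a (- b) = - lam a b.
Proof. by apply: (addrI (lam a b)); rewrite -lamD !subrr lam0. Qed.

Lemma lamB a b c : lam a (b - c) = lam a b - lam a c.
Proof. by rewrite lamD lamN. Qed.

Lemma e0 : e 0 = 1%g.
Proof. by apply: (mulgI (e 0)); rewrite -eM lam0 addr0 mulg1. Qed.

Lemma lam0l b : lam 0 b = b.
Proof. by apply: e_inj; rewrite -[lam 0 b]add0r eM e0 mulg1. Qed.

(** The two bracketings of a o b o c agree because composition is associative. *)
Lemma lamM a b c : lam (a + lam a b) c = lam a (lam b c).
Proof.
apply: (addrI (a + lam a b)); apply: e_inj.
by rewrite -[in RHS]addrA -lamD !eM mulgA.
Qed.

Definition bgroup : {set {perm X}} := e @: setT.

Lemma mem_bgroup a : e a \in bgroup. Proof. exact: imset_f. Qed.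

Lemma bgroup_set : group_set bgroup.
Proof.
apply/group_setP; split; first by rewrite -e0 mem_bgroup.
by move=> _ _ /imsetP[a _ ->] /imsetP[b _ ->]; rewrite -eM mem_bgroup.
Qed.
Canonical bgroup_group := Group bgroup_set.

Lemma bgroupP g : reflect (exists a, g = e a) (g \in bgroup).
Proof.
by apply: (iffP imsetP) => [[a _ ->]|[a ->]]; exists a.
Qed.

(** [b] is the multiplicative inverse of [a], in general not [- a]. *)
Lemma e_invP a : exists b, e b = (e a)^-1%g.
Proof.
have: (e a)^-1%g \in bgroup by rewrite groupV mem_bgroup.
by case/bgroupP=> b ->; exists b.
Qed.

Lemma lamK a b c : e b = (e a)^-1%g -> lam a (lam b c) = c.
Proof.
move=> E; rewrite -lamM -[RHS]lam0l; congr lam.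
by apply: e_inj; rewrite eM E mulVg e0.
Qed.

Definition left_ideal (L : {set A}) :=
  [/\ 0 \in L, {in L &, forall a b, a + b \in L} & forall a b, b \in L -> lam a b \in L].

Section LeftIdeal.
Variable L : {set A}.
Hypothesis LL : left_ideal L.

Lemma lideal0 : 0 \in L. Proof. by case: LL. Qed.
Lemma lidealD a b : a \in L -> b \in L -> a + b \in L.
Proof. by case: LL => _ + _; apply. Qed.
(** In a finite group a subset with the unit that is closed under the operation is a subgroup. *)
Lemma lidealN a : a \in L -> - a \in L.
Proof.
have gL : group_set L by apply/group_setP; case: LL.
exact: (@groupVr _ (Group gL)).
Qed.
Lemma lidealB a b : a \in L -> b \in L -> a - b \in L.
Proof. by move=> La Lb; rewrite lidealD ?lidealN. Qed.
Lemma lideal_lam a b : (lam a b \in L) = (b \in L).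
Proof.
have stab c d : d \in L -> lam c d \in L by case: LL => _ _; apply.
apply/idP/idP => [/stab h|/stab //]; have [a' Ea'] := e_invP a.
by have := h a'; rewrite lamK // Ea' invgK.
Qed.

Lemma mem_imlideal a : (e a \in e @: L) = (a \in L).
Proof. exact: mem_imset. Qed.

Lemma imlideal_set : group_set (e @: L).
Proof.
apply/group_setP; split; first by rewrite -e0 imset_f ?lideal0.
move=> _ _ /imsetP[a La ->] /imsetP[b Lb ->].
by rewrite -eM imset_f // lidealD ?lideal_lam.
Qed.

Lemma imlideal_sub : e @: L \subset bgroup.
Proof. by apply: imsetS; apply: subsetT. Qed.

(* The cosets b o L and b + L coincide, as b o l = b + lam b l. *)
Lemma mem_imlideal_coset a b : ((e a * (e b)^-1)%g \in e @: L) = (a - b \in L).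
Proof.
have /bgroupP[c Ec] : (e a * (e b)^-1)%g \in bgroup.
  by rewrite groupM ?groupV ?mem_bgroup.
have : e a = e (b + lam b c) by rewrite eM -Ec mulgKV.
by move/e_inj=> E; rewrite Ec mem_imlideal E addrC addKr lideal_lam.
Qed.
End LeftIdeal.

(** * Kernels of the actions on the iterated retracts *)

Section Ret.

Lemma ret_relxx k x : ret_rel sig k x x.
Proof. by elim: k x => [|k IH] x /=; [exact: eqxx | exact/forallP]. Qed.

Lemma ret_rel_trans k y x z :
  ret_rel sig k x y -> ret_rel sig k y z -> ret_rel sig k x z.
Proof.
elim: k x y z => [|k IH] x y z /=; first by move/eqP->.
by move=> /forallP h1 /forallP h2; apply/forallP=> t; apply: (IH _ _ _ (h1 t) (h2 t)).
Qed.

Lemma ret_relS k x y : ret_rel sig k x y -> ret_rel sig k.+1 x y.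
Proof.
elim: k x y => [|k IH] x y; first by move/eqP->; apply: ret_relxx.
by move/forallP=> h; apply/forallP=> z; apply: IH.
Qed.

(* The preimage under e of the kernel of the action on Ret^k(X). *)
Definition rker k : {set A} := [set a | [forall x, ret_rel sig k (e a x) x]].

Lemma rkerP k a : reflect (forall x, ret_rel sig k (e a x) x) (a \in rker k).
Proof. by rewrite inE; apply: forallP. Qed.

Lemma rkerS k : rker k \subset rker k.+1.
Proof. by apply/subsetP=> a /rkerP h; apply/rkerP=> x; apply: ret_relS. Qed.

Lemma rker0 : rker 0 = [set 0].
Proof.
apply/setP=> a; rewrite in_set1; apply/rkerP/eqP => [h|-> x]; last by rewrite e0 perm1 /=.
by apply: e_inj; apply/permP=> x; rewrite e0 perm1; apply/eqP/(h x).
Qed.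

Definition ret_inv k := forall a x y, ret_rel sig k x y -> ret_rel sig k (e a x) (e a y).

(** As the relation at level [k] is invariant under the group, the quotient of sigma_x and sigma_y
    acts trivially on Ret^k exactly when [x] and [y] are related at level [k.+1];
    [mem_imlideal_coset] makes this additive. *)
Lemma ret_relSE k : ret_inv k -> left_ideal (rker k) ->
  forall x y, ret_rel sig k.+1 x y = (s x - s y \in rker k).
Proof.
move=> inv LL x y; rewrite -mem_imlideal_coset //.
have /bgroupP[c Ec] : (e (s x) * (e (s y))^-1)%g \in bgroup.
  by rewrite groupM ?groupV ?mem_bgroup.
rewrite Ec mem_imlideal; apply/forallP/rkerP => h z.
  have [b Eb] := e_invP (s y).
  have := inv b _ _ (h z); rewrite -Ec permM -!e_s Eb.
  by rewrite permK.
have := inv (s y) _ _ (h z); rewrite -Ec permM -!e_s.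
by rewrite -permM mulgV perm1 || rewrite permKV.
Qed.

(** This is the socle series: [rker k.+1] modulo [rker k] is the socle of the quotient by [rker k].
    The condition at the generators [s x] is [ret_relSE], and the [b] satisfying it are closed under
    addition. *)
Lemma rker_SE k : ret_inv k -> left_ideal (rker k) ->
  forall a, reflect (forall b, lam a b - b \in rker k) (a \in rker k.+1).
Proof.
move=> inv LL a; apply: (iffP (rkerP _ _)) => h; last first.
  by move=> x; rewrite ret_relSE // -lam_s h.
pose L := [set b | lam a b - b \in rker k].
have LE b : (b \in L) = (lam a b - b \in rker k) by rewrite in_set.
suff gen b : b \in L by move=> b; rewrite -LE.
apply: s_gen b => [|b c|x]; rewrite !LE.
- by rewrite lam0 subrr lideal0.
- by move=> h1 h2; rewrite lamD opprD addrACA lidealD.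
by rewrite lam_s -ret_relSE.
Qed.

(** Both claims are proved together because [ret_relSE] at level [k] uses both. Closure of the next
    kernel under the product comes first, then closure under [lam], then under addition. *)
Lemma ret_rker k : ret_inv k /\ left_ideal (rker k).
Proof.
elim: k => [|k [inv LL]].
  split; first by move=> a x y /eqP-> /=.
  rewrite rker0; split=> [|a b|a b]; rewrite !in_set1 //.
    by move=> /eqP-> /eqP->; rewrite addr0.
  by move/eqP->; rewrite lam0.
have SE := ret_relSE inv LL; have KE := rker_SE inv LL.
have inv' : ret_inv k.+1.
  by move=> a x y; rewrite !SE -!lam_s -lamB lideal_lam.
have circ_closed a b : a \in rker k.+1 -> b \in rker k.+1 -> a + lam a b \in rker k.+1.
  move=> /KE ha /KE hb; apply/KE=> c; rewrite lamM.
  by rewrite -(subrK (lam b c) (lam a _)) -addrA lidealD.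
have lam_closed h g : g \in rker k.+1 -> lam h g \in rker k.+1.
  move=> Dg; have [h' Eh'] := e_invP h.
  have /bgroupP[t Et] : ((e h)^-1 * (e g * e h))%g \in bgroup.
    by rewrite !groupM ?groupV ?mem_bgroup.
  have Dt : t \in rker k.+1.
    apply/rkerP=> x; rewrite -Et !permM.
    have /rkerP/(_ ((e h)^-1%g x)) := Dg.
    by move/(inv' h); rewrite permKV.
  (* [t] is the conjugate h o g o h^-1, so t o h = h o g. Hence [lam h g] is [t] plus an element of
     [rker k], a sum that is rewritten as a product. *)
  have E : t + lam t h = h + lam h g.
    by apply: e_inj; rewrite !eM -Et mulKVg.
  have -> : lam h g = t + (lam t h - h) by rewrite addrA E addrC addKr.
  have [t' Et'] := e_invP t.
  rewrite -(@lamK t t' (lam t h - h)) //; apply: circ_closed => //.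
  apply: (subsetP (rkerS k)); rewrite lideal_lam //.
  by move/KE: Dt; apply.
split=> //; split=> //; first by apply: (subsetP (rkerS k)); apply: lideal0.
(* With [a'] the multiplicative inverse of [a], the sum a + b is the product of [a] and
   [lam a' b]. *)
move=> a b Da Db; have [a' Ea'] := e_invP a.
by rewrite -(@lamK a a' b) //; apply: circ_closed => //; apply: lam_closed.
Qed.

Lemma ret_relP k a x y : ret_rel sig k x y -> ret_rel sig k (e a x) (e a y).
Proof. exact: (ret_rker k).1. Qed.

Lemma ret_relJ k a x y : ret_rel sig k (e a x) (e a y) = ret_rel sig k x y.
Proof.
apply/idP/idP; last exact: ret_relP.
by have [b Eb] := e_invP a; move/(@ret_relP _ b); rewrite Eb !permK.
Qed.

Lemma rker_lideal k : left_ideal (rker k).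
Proof. exact: (ret_rker k).2. Qed.

Lemma rker_lam k a b : a \in rker k.+1 -> lam a b - b \in rker k.
Proof. by have [inv LL] := ret_rker k; move/(rker_SE inv LL). Qed.

Lemma rker1P a : reflect (forall b, lam a b = b) (a \in rker 1).
Proof.
have [inv LL] := ret_rker 0.
apply: (iffP (rker_SE inv LL _)) => h b; have := h b; rewrite rker0 inE subr_eq0.
  by move/eqP.
by move->.
Qed.

Definition nker k : {set {perm X}} := e @: rker k.
Definition nker_group k : {group {perm X}} := Group (imlideal_set (rker_lideal k)).

Lemma nkerP k a : reflect (forall x, ret_rel sig k (e a x) x) (e a \in nker k).
Proof. by rewrite mem_imlideal; apply: rkerP. Qed.

Lemma nker_normal k : (nker_group k <| bgroup)%g.
Proof.
apply/andP; split; first exact: imlideal_sub.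
apply/subsetP=> _ /bgroupP[h ->]; rewrite inE; apply/subsetP=> _ /imsetP[_ /imsetP[g Dg ->] ->].
have /bgroupP[c Ec] : (e g ^ e h)%g \in bgroup by rewrite groupJ ?mem_bgroup.
rewrite Ec; apply/nkerP=> x; rewrite -Ec !permM.
have /rkerP/(_ ((e h)^-1%g x)) := Dg.
by move/(ret_relP h); rewrite permKV.
Qed.

(** For [a], [b] in [rker k.+1] the products a o b and b o a are both congruent to a + b modulo
    [rker k]. Taking [a], [b] from the inverses of [x], [y] writes the commutator as a quotient of
    these products. *)
Lemma nker_der k : ((nker_group k.+1)^`(1) \subset nker_group k)%g.
Proof.
rewrite gen_subG; apply/subsetP=> _ /imset2P[x y Nx Ny ->].
have /imsetP[a Da Ea] : (x^-1)%g \in nker_group k.+1 by rewrite groupV.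
have /imsetP[b Db Eb] : (y^-1)%g \in nker_group k.+1 by rewrite groupV.
have -> : [~ x, y]%g = (e (b + lam b a) * (e (a + lam a b))^-1)%g.
  by rewrite !eM -Ea -Eb invMg !invgK commgEl /conjg !mulgA.
rewrite mem_imlideal_coset; last exact: rker_lideal.
have := lidealB (rker_lideal k) (rker_lam a Db) (rker_lam b Da).
by rewrite opprB opprD [b + lam b a]addrC addrACA.
Qed.

End Ret.

(** * Sylow left ideals and their products *)

Lemma lideal_Sylow (q : nat) (L : {set A}) : 0 \in L ->
  {in L &, forall a b, a + b \in L} -> #|L| = (#|A|`_q)%N -> left_ideal L.
Proof.
move=> L0 LD cL; split=> // a b Lb.
have gL : group_set L by apply/group_setP.
have hL : q.-Hall([set: A]) (Group gL) by rewrite pHallE subsetT cardsT /= cL.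
have nL : Group gL <| [set: A].
  by rewrite /normal subsetT; apply/cents_norm/centsP => c _ d _; apply: addrC.
pose f := Morphism (fun c d (_ : c \in [set: A]) (_ : d \in [set: A]) => lamD a c d).
(* A Sylow subgroup of an abelian group consists of all its [q]-elements, which the endomorphism
   [lam a] preserves. *)
have -> : (lam a b \in L) = (q.-elt (f b))%g.
  exact: (mem_normal_Hall hL nL (in_setT _)).
by apply: morph_p_elt; rewrite ?in_setT // -(mem_normal_Hall hL nL (in_setT _)).
Qed.

(** Since a o b = a + lam a b and [lam a] permutes [L2], the product of the two left ideals equals
    their sum. *)
Lemma lideal_comp (L1 L2 : {set A}) : left_ideal L1 -> left_ideal L2 ->
  let L := [set a + b | a in L1, b in L2] in
  left_ideal L /\ setcomp (e @: L1) (e @: L2) = e @: L.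
Proof.
move=> I1 I2 L; split.
  split; first by rewrite -[0]addr0; apply: imset2_f; apply: lideal0.
    move=> _ _ /imset2P[a b La Lb ->] /imset2P[c d Lc Ld ->].
    by rewrite addrACA; apply: imset2_f; apply: lidealD.
  move=> c _ /imset2P[a b La Lb ->].
  by rewrite lamD; apply: imset2_f; rewrite lideal_lam.
apply/setP=> g; apply/imset2P/imsetP.
  case=> _ _ /imsetP[a La ->] /imsetP[b Lb ->] ->.
  by exists (a + lam a b); [apply: imset2_f; rewrite ?lideal_lam | rewrite eM].
case=> _ /imset2P[a b La Lb ->] ->.
have [a' Ea'] := e_invP a; rewrite -(lamK b Ea') eM.
by exists (e a) (e (lam a' b)); rewrite ?imset_f ?lideal_lam.
Qed.

(** The order of a product of two subgroups divides the product of their orders, while its index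
    divides both indices; so Hall subgroups multiply to a Hall subgroup for the union of the
    primes. *)
Lemma bigcomp_Hall (I : finType) (Q : I -> {set A}) (p : I -> nat) (r : seq I) :
  (forall i, left_ideal (Q i)) -> (forall i, (p i).-Hall(bgroup) (e @: Q i)) ->
  exists2 L, left_ideal L &
    \big[@setcomp X/[set 1%g]]_(i <- r) (e @: Q i) = e @: L /\
    [pred q | q \in [seq p i | i <- r]].-Hall(bgroup) (e @: L).
Proof.
move=> IQ HQ; elim: r => [|i r [L IL [EL HL]]].
  exists [set 0].
    split=> [|a b|a b]; rewrite !in_set1 // => /eqP->; last by rewrite lam0.
    by move/eqP->; rewrite addr0.
  rewrite big_nil imset_set1 e0; split=> //.
  rewrite /pHall sub1set group1 /pgroup cards1 /=.
  by apply/pnatP=> // q _ _; rewrite !inE.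
have [IL' EL'] := lideal_comp (IQ i) IL.
exists [set a + b | a in Q i, b in L] => //.
rewrite big_cons EL EL'; split=> //.
pose gQ := Group (imlideal_set (IQ i)).
pose gL := Group (imlideal_set IL); pose gM := Group (imlideal_set IL').
suff: [pred q | q \in [seq p i | i <- i :: r]].-Hall(bgroup) gM by [].
(* [setcomp] is the product of subsets with the factors exchanged. *)
have EM : gM = (gL * gQ)%g :> {set _}.
  rewrite /= -EL'; apply/setP=> g.
  by apply/imset2P/imset2P=> -[x y Hx Hy ->]; exists y x.
have [sQ sL] : gQ \subset gM /\ gL \subset gM by rewrite EM mulG_subl mulG_subr.
have /and3P[_ pL iL] := HL; have /and3P[_ pQ iQ] := HQ i.
have sM : gM \subset bgroup by apply: imlideal_sub.
rewrite /pHall sM /=; apply/andP; split.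
  rewrite /pgroup; apply: (@pnat_dvd _ (#|gL| * #|gQ|)%N); first by rewrite mul_cardG EM dvdn_mulr.
  rewrite pnatM; apply/andP; split.
    by apply: sub_in_pnat pL => q _; rewrite !inE => ->; rewrite orbT.
  by apply: sub_in_pnat pQ => q _; rewrite !inE => ->.
apply/pnatP; first exact: indexg_gt0.
move=> q q_pr qd; rewrite !inE negb_or; apply/andP; split.
  have /pnatP/(_ q) := iQ; rewrite indexg_gt0 !inE; apply=> //.
  exact: dvdn_trans qd (@indexgS _ bgroup_group _ _ sQ).
have /pnatP/(_ q) := iL; rewrite indexg_gt0 !inE; apply=> //.
exact: dvdn_trans qd (@indexgS _ bgroup_group _ _ sL).
Qed.

(** * Stabilizers of retract classes and the Hall property of the kernels *)

Section Stabilizers.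
Variables (x0 : X) (K : nat).
Hypotheses (trans : forall x, exists a, e a x0 = x)
  (retK : forall x y, ret_rel sig K x y).

Definition cstab k : {set {perm X}} := [set g in bgroup | ret_rel sig k (g x0) x0].

Lemma cstab_set k : group_set (cstab k).
Proof.
apply/group_setP; split; first by rewrite inE group1 perm1 ret_relxx.
move=> g h; rewrite !inE => /andP[Gg hg] /andP[Gh hh]; rewrite groupM // permM /=.
have /bgroupP[b Eb] := Gh; apply: ret_rel_trans hh.
by rewrite Eb ret_relJ.
Qed.
Canonical cstab_group k := Group (cstab_set k).

Lemma cstab_sub k : cstab k \subset bgroup.
Proof. by apply/subsetP=> g; rewrite inE => /andP[]. Qed.

Lemma cstabS k : cstab k \subset cstab k.+1.
Proof.
apply/subsetP=> g; rewrite !inE => /andP[-> /=]; exact: ret_relS.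
Qed.

Lemma cstabT : cstab_group K = bgroup_group.
Proof. by apply: group_inj; apply/setP=> g; rewrite inE retK andbT. Qed.

Lemma nkerT : nker K = bgroup.
Proof.
rewrite /nker; suff -> : rker K = setT by [].
by apply/setP=> a; rewrite in_setT; apply/rkerP.
Qed.

Lemma nker0 : nker 0 = 1%g.
Proof. by rewrite /nker rker0 imset_set1 e0. Qed.

Lemma nker_cstab k : nker_group k \subset cstab k.
Proof. by apply/subsetP=> _ /imsetP[a /rkerP h ->]; rewrite inE mem_bgroup h. Qed.

Lemma nkerS k : nker_group k \subset nker_group k.+1.
Proof. exact/imsetS/rkerS. Qed.

(** The conjugates of [g] fixing the class of [x0] means that [g] fixes the class of every point of
    the orbit of [x0], which is [X]. *)
Lemma nker_core k g : g \in nker_group k.+1 ->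
  {in bgroup, forall h, (g ^ h)%g \in cstab k} -> g \in nker_group k.
Proof.
case/imsetP=> a _ -> h; apply/nkerP=> x; have [b <-] := trans x.
have := h (e b)^-1%g; rewrite groupV mem_bgroup inE => /(_ isT) /andP[_].
by rewrite /conjg invgK !permM; move/(ret_relP b); rewrite permKV.
Qed.

Lemma index_cstab0 : #|bgroup : cstab 0| = #|X|.
Proof.
rewrite -cardsT; have <- : orbit 'P bgroup x0 = [set: X].
  apply/setP=> x; rewrite in_setT; apply/orbitP.
  by have [a <-] := trans x; exists (e a); rewrite ?mem_bgroup.
rewrite card_orbit; congr #|_ : _|.
by apply/setP=> g; rewrite !inE sub1set inE /=.
Qed.

Hypothesis sqfX : forall m m', (m * m')%N = #|X| -> coprime m m'.

Let sqfG m m' : (m * m')%N = #|bgroup : cstab 0| -> coprime m m'.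
Proof. by rewrite index_cstab0; apply: sqfX. Qed.

Lemma nker_mono j k : (j <= k)%N -> nker_group j \subset nker_group k.
Proof. exact: (@mono_sN _ nker_group nkerS). Qed.

Lemma nker_Hall k : (k <= K)%N -> \pi(#|cstab k : cstab 0|).-Hall(bgroup) (nker_group k).
Proof.
move=> le; apply: (@chain_Hall _ bgroup_group cstab_group nker_group K) => //.
- exact: cstabS.
- exact: cstab_sub.
- exact: nker_normal.
- exact: nker_cstab.
- exact: nkerS.
- exact: nker0.
- by apply: group_inj; apply: nkerT.
- exact: nker_der.
- exact: nker_core.
Qed.

Lemma order_nker k p g : prime p -> g \in nker_group k.+1 -> (p.-elt g)%g ->
  (<[g]> :&: nker_group k = 1)%g -> (#[g]%g %| p)%N.
Proof.
apply: (@order_chain _ bgroup_group cstab_group nker_group) => //.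
- exact: cstabS.
- exact: cstab_sub.
- exact: nker_normal.
- exact: nker_cstab.
- exact: nker_der.
- exact: nker_core.
Qed.

(** At level [K] both the kernel and the stabilizer are the whole group, so [nker_Hall] bounds its
    primes by those of |[X]|; conversely |[X]| is the index of a stabilizer. *)
Lemma pi_bgroup : \pi(#|bgroup|) =i \pi(#|X|).
Proof.
move=> q; have [_ + _] := and3P (nker_Hall (leqnn K)).
rewrite /pgroup [gval _]nkerT -[cstab K]/(gval (cstab_group K)) cstabT index_cstab0.
move=> h; apply/idP/idP; first exact: pnatPpi h.
apply: pi_of_dvd; last exact: (cardG_gt0 bgroup_group).
by rewrite -index_cstab0; apply: dvdn_indexg.
Qed.

(** * Hall subgroups between consecutive kernels *)

Section Between.
Variables (k : nat) (pi : nat_pred) (M : {group {perm X}}).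
Hypotheses (HM : pi.-Hall(bgroup) M)
  (skM : nker_group k \subset M) (sMk : M \subset nker_group k.+1).

(** [M] contains the derived subgroup of [nker k.+1], so it is a normal Hall subgroup there, hence
    characteristic. *)
Lemma Hall_between_normal : M <| bgroup.
Proof.
have nM : M <| nker_group k.+1.
  by apply: sub_der1_normal => //; apply: subset_trans (nker_der k) skM.
have HM' : pi.-Hall(nker_group k.+1) M.
  exact: (@pHall_subl _ pi bgroup_group) sMk (normal_sub (nker_normal _)) HM.
rewrite -(normal_Hall_pcore HM' nM).
exact: (char_normal_trans (pcore_char _ _) (nker_normal _)).
Qed.

(* With m = #|M|, a coset of nker k is fixed by (g q^-1)^m, which is g^m modulo
   nker k because nker k.+1 / nker k is abelian; hence g^m lies in nker k. *)
Lemma mem_Hall_between g : g \in bgroup ->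
  (forall x, exists2 q, q \in M & g x = q x) -> g \in M.
Proof.
move=> Gg orb; set m := #|M|.
have sub_ret h x : h \in nker_group k.+1 -> ret_rel sig k.+1 (h x) x.
  by case/imsetP=> a /rkerP ha ->; apply: ha.
have Ng : g \in nker_group k.+1.
  have /bgroupP[a Ea] := Gg; rewrite Ea; apply/nkerP=> x; rewrite -Ea.
  by have [q Mq ->] := orb x; apply: sub_ret; apply: (subsetP sMk).
have nN : {subset nker_group k.+1 <= 'N(nker_group k)}.
  apply/subsetP; apply: subset_trans (normal_norm (nker_normal k)).
  exact: normal_sub (nker_normal k.+1).
have abN : abelian (nker_group k.+1 / nker_group k)%g.
  exact/sub_der1_abelian/nker_der.
have Ngm : (g ^+ m)%g \in nker_group k.
  have : (g ^+ m)%g \in bgroup by rewrite groupX.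
  case/bgroupP=> a Ea; rewrite Ea; apply/nkerP=> x; rewrite -Ea.
  have [q Mq Eq] := orb x; have Nq := subsetP sMk _ Mq.
  (* [q], and so [u], depends on [x], but the exponent [m] kills every [q] in [M]. *)
  pose u := (g * q^-1)%g.
  have Nu : u \in nker_group k.+1 by rewrite groupM ?groupV.
  have ux : (u ^+ m)%g x = x.
    have ux1 : u x = x by rewrite permM Eq permK.
    by elim: m {Ea} => [|j IH]; rewrite ?perm1 // expgS permM ux1.
  have /imsetP[c Dc Ec] : (u ^- m * g ^+ m)%g \in nker_group k.
    apply: coset_idr; first by rewrite groupM ?groupV ?groupX ?nN.
    have cg : coset (nker_group k) g \in (nker_group k.+1 / nker_group k)%g.
      exact: mem_quotient.
    have cq : coset (nker_group k) q \in (nker_group k.+1 / nker_group k)%g.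
      exact: mem_quotient.
    have cc : commute (coset (nker_group k) g) (coset (nker_group k) q)^-1.
      by apply: (centsP abN); rewrite ?groupV.
    have cqm : (coset (nker_group k) q ^+ m)%g = 1%g.
      by rewrite -morphX ?nN //= expg_cardG // morph1.
    rewrite morphM ?groupV ?groupX ?nN //= morphV ?groupX ?nN //= !morphX ?nN //=.
    rewrite morphM ?groupV ?nN //= morphV ?nN //= expgMn // expVgn cqm invg1 mulg1.
    exact: mulVg.
  have -> : (g ^+ m)%g = (u ^+ m * e c)%g by rewrite -Ec mulKVg.
  by rewrite permM ux; apply/rkerP.
(* As g^m lies in [M], the order of [g] divides m * m, so [g] is a [pi]-element. *)
rewrite (mem_normal_Hall HM Hall_between_normal Gg).
have /and3P[_ pM _] := HM.
apply: (@pnat_dvd _ (m * m)%N); last by rewrite pnatM -/m -/(pgroup _ _) pM.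
by rewrite order_dvdn expgM -[_ == _]/(_ == 1%g) (expg_cardG (subsetP skM _ Ngm)).
Qed.
End Between.

Lemma sub_nker k (M : {group {perm X}}) : (k <= K)%N -> M \subset bgroup ->
  (forall q, prime q -> (q %| #|M|)%N -> (q %| #|nker k|)%N) -> M \subset nker_group k.
Proof.
move=> le sM h; have HN := nker_Hall le.
rewrite (sub_normal_Hall HN (nker_normal k) sM).
apply/pnatP=> // q q_pr /h qd; have /and3P[_ pN _] := HN.
by apply: (pnatPpi pN); rewrite mem_primes q_pr cardG_gt0 qd.
Qed.

(** A normal [pi]-subgroup lies in every Hall [pi]-subgroup. *)
Lemma nker_sub k pi (M : {group {perm X}}) : pi.-Hall(bgroup) M ->
  (forall q, prime q -> (q %| #|nker k|)%N -> q \in pi) -> nker_group k \subset M.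
Proof.
move=> HM h; apply: subset_trans (@pcore_sub_Hall pi _ bgroup_group _ HM).
by apply: pcore_max (nker_normal k); apply/pnatP.
Qed.

(** * Sylow subgroups and levels *)

Section Main.
Variables (n : nat) (p : 'I_n -> nat) (Q : 'I_n -> {set A}).
Hypotheses (p_pr : forall i, prime (p i)) (cX : #|X| = (\prod_(i < n) p i)%N)
  (IQ : forall i, left_ideal (Q i))
  (HQ : forall i, (p i).-Hall(bgroup) (e @: Q i)).

Definition syl i : {set {perm X}} := e @: Q i.
Definition syl_group i : {group {perm X}} := Group (imlideal_set (IQ i)).

Lemma dvd_p_bgroup i : (p i %| #|bgroup|)%N.
Proof.
have : p i \in \pi(#|bgroup|).
  rewrite pi_bgroup mem_primes p_pr cX prodn_gt0 /= => [|j]; last exact: prime_gt0.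
  by rewrite (bigD1 i) // dvdn_mulr.
by rewrite mem_primes => /and3P[].
Qed.

Lemma prime_dvd_bgroup q : prime q -> (q %| #|bgroup|)%N -> exists i, q = p i.
Proof.
move=> q_pr qd; have : q \in \pi(#|X|).
  by rewrite -pi_bgroup mem_primes q_pr qd (cardG_gt0 bgroup_group).
rewrite mem_primes cX => /and3P[_ _]; rewrite Euclid_dvd_prod // big_orE => /existsP[i] /=.
by rewrite dvdn_prime2 // => /eqP; exists i.
Qed.

Lemma level_ex i : exists k, (p i %| #|nker k|)%N.
Proof. by exists K; rewrite nkerT dvd_p_bgroup. Qed.

(* The unique k such that p_i divides |nker k.+1 : nker k|. *)
Definition level i := (ex_minn (level_ex i)).-1.

Lemma dvd_nker i k : (p i %| #|nker k|)%N = (level i < k)%N.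
Proof.
rewrite /level; case: ex_minnP => -[|m] pm minm /=.
  (* [nker 0] is trivial, so the minimum is positive and its predecessor in [level] is genuine. *)
  by move: pm; rewrite nker0 cards1 dvdn1 => /eqP E; have := p_pr i; rewrite E.
apply/idP/idP => [/minm //|le]; apply: dvdn_trans pm _.
exact: cardSg (nker_mono le).
Qed.

Lemma level_lt i : (level i < K)%N.
Proof. by rewrite -dvd_nker nkerT dvd_p_bgroup. Qed.

Lemma syl_pgroup i : (p i).-group (syl_group i).
Proof. by case/and3P: (HQ i). Qed.

Lemma syl_sub_nker i : syl_group i \subset nker_group (level i).+1.
Proof.
apply: sub_nker; [exact: level_lt | exact: imlideal_sub |] => q q_pr qd.
have := pnatPpi (syl_pgroup i) (_ : q \in _).
rewrite mem_primes q_pr cardG_gt0 qd => /(_ isT) /eqP->.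
by rewrite dvd_nker.
Qed.

Lemma syl_nkerI i : syl_group i :&: nker_group (level i) = 1%g.
Proof.
apply: coprime_TIg; apply: (pnat_coprime (syl_pgroup i)).
by rewrite p'natE // dvd_nker ltnn.
Qed.

Lemma sylI a i : a \in Q i -> a \in rker (level i) -> a = 0.
Proof.
move=> Qa Ra; apply: e_inj; apply/eqP; rewrite e0 -in_set1.
by rewrite -[[set 1%g]]/(1%g : {set _}) -(syl_nkerI i) inE !mem_imlideal Qa.
Qed.

(** [lam a b - b] lies in the left ideal [Q i], and in [rker (level i)] because [a] is one level
    higher; these meet in 0. *)
Lemma syl_trivial i a b : a \in Q i -> b \in Q i -> lam a b = b.
Proof.
move=> Qa Qb; apply/eqP; rewrite -subr_eq0; apply/eqP/(@sylI _ i).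
  by rewrite lidealB ?lideal_lam.
apply: rker_lam; rewrite -mem_imlideal.
by apply: (subsetP (syl_sub_nker i)); rewrite /= mem_imlideal.
Qed.

Lemma syl_expg i a m : a \in Q i -> e (a *+ m) = (e a ^+ m)%g.
Proof.
move=> Qa; suff [] : a *+ m \in Q i /\ e (a *+ m) = (e a ^+ m)%g by [].
elim: m => [|m [Qm Em]]; first by rewrite mulr0n lideal0 // e0.
rewrite mulrS lidealD // -[X in a + X](@syl_trivial i a) // eM Em expgSr.
by split.
Qed.

(** In a trivial brace multiples are powers, so the multiplicative bound [order_nker] applies. *)
Lemma syl_elementary i a : a \in Q i -> a *+ p i = 0.
Proof.
move=> Qa; apply: e_inj; rewrite (syl_expg _ Qa) e0; apply/eqP; rewrite -order_dvdn.
have Pa : e a \in syl_group i by rewrite /= mem_imlideal.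
apply: (@order_nker (level i)) => //.
- exact: (subsetP (syl_sub_nker i)).
- exact: mem_p_elt (syl_pgroup i) Pa.
apply/trivgP; rewrite -(syl_nkerI i); apply: setSI; by rewrite cycle_subG.
Qed.

(** The product is a Hall subgroup for a set containing all primes of the group order. *)
Lemma bigsyl_all : \big[@setcomp X/[set 1%g]]_(j < n) syl j = bgroup.
Proof.
have [L IL [-> HL]] := bigcomp_Hall (index_enum 'I_n) IQ HQ.
apply: (@pHall_id _ _ (Group (imlideal_set IL)) bgroup_group HL).
apply/pnatP=> // q q_pr /(prime_dvd_bgroup q_pr)[i ->].
by rewrite inE map_f // mem_index_enum.
Qed.

(** * Products of Sylow subgroups taken by increasing level *)

Section Sorted.
Variable t : 'S_n.
Hypothesis t_sorted : forall i j : 'I_n, (i <= j)%N -> (level (t i) <= level (t j))%N.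

Definition piQ (i : nat) : nat_pred := [pred q | [exists j : 'I_n, (j < i)%N && (q == p (t j))]].

Lemma Qprod_Hall i : exists2 L, left_ideal L &
  Qprod syl t i = e @: L /\ (piQ i).-Hall(bgroup) (e @: L).
Proof.
pose r := [seq t j | j <- [seq j : 'I_n <- index_enum 'I_n | (j < i)%N]].
have [L IL [EL HL]] := bigcomp_Hall r IQ HQ.
exists L => //; split; first by rewrite -EL big_map big_filter.
have Epi : [pred q | q \in [seq p i | i <- r]] =i piQ i.
  move=> q; rewrite !inE -map_comp; apply/mapP/existsP => [[j]|[j /andP[lt /eqP Eq]]].
    by rewrite mem_filter => /andP[lt _] ->; exists j; rewrite lt /=.
  by exists j; rewrite // mem_filter lt mem_index_enum.
by have := HL; rewrite (@eq_pHall _ _ _ bgroup_group (Group (imlideal_set IL)) Epi).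
Qed.

Lemma Qprod_group_set i : group_set (Qprod syl t i).
Proof. by have [L IL [-> _]] := Qprod_Hall i; apply: imlideal_set. Qed.
Definition Qprod_group i : {group {perm X}} := Group (Qprod_group_set i).

Lemma Qprod_pHall i : (piQ i).-Hall(bgroup) (Qprod_group i).
Proof. by rewrite /=; have [L IL [-> HL]] := Qprod_Hall i. Qed.

(** The primes of this kernel have level below that of [t j], so sorting places them before position
    [j]. *)
Lemma nker_sub_Qprod (j : 'I_n) i : (j <= i)%N ->
  nker_group (level (t j)) \subset Qprod_group i.
Proof.
move=> le; apply: nker_sub (Qprod_pHall i) _ => q q_pr qd.
have [u Eq] : exists u, q = p u.
  apply: prime_dvd_bgroup => //; apply: dvdn_trans qd _.
  exact: (cardSg (normal_sub (nker_normal _))).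
move: qd; rewrite Eq dvd_nker inE => lt; apply/existsP; exists (t^-1%g u).
rewrite permKV eqxx andbT; apply: leq_trans le; rewrite ltnNge; apply/negP.
by move/t_sorted; rewrite permKV leqNgt lt.
Qed.

Lemma Qprod_sub_nker (j : 'I_n) : Qprod_group j.+1 \subset nker_group (level (t j)).+1.
Proof.
have /and3P[sQ pQ _] := Qprod_pHall j.+1.
apply: sub_nker => //; first exact: level_lt.
move=> q q_pr qd; have := pnatPpi pQ (_ : q \in _).
rewrite mem_primes q_pr cardG_gt0 qd inE => /(_ isT) /existsP[i /andP[le /eqP->]].
by rewrite dvd_nker ltnS t_sorted.
Qed.

Lemma Qprod_normal (j : 'I_n) : Qprod_group j.+1 <| bgroup.
Proof.
apply: Hall_between_normal (Qprod_pHall _) _ (Qprod_sub_nker j).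
exact: nker_sub_Qprod.
Qed.

Lemma mem_Qprod (j : 'I_n) g : g \in bgroup ->
  (forall x, exists2 q, q \in Qprod_group j.+1 & g x = q x) -> g \in Qprod_group j.+1.
Proof.
apply: mem_Hall_between (Qprod_pHall _) _ (Qprod_sub_nker j) _.
exact: nker_sub_Qprod.
Qed.

(** The two sums differ by [lam a b - b] up to sign, an element of the kernel at level
    [level (t j)], which [Qprod t j] contains. *)
Lemma Qprod_central (j : 'I_n) a b : e a \in Qprod_group j.+1 ->
  (e (a + b) * (e (a + lam a b))^-1)%g \in Qprod_group j.
Proof.
move/(subsetP (Qprod_sub_nker j)); rewrite /= mem_imlideal => Ra.
apply: (subsetP (nker_sub_Qprod (leqnn j))).
rewrite /= mem_imlideal_coset; last exact: rker_lideal.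
rewrite [a + b]addrC opprD addrA addrK.
by rewrite -opprB lidealN ?rker_lam //; apply: rker_lideal.
Qed.

Lemma Qprod0 : Qprod syl t 0 = [set 1%g].
Proof. exact: big_pred0. Qed.

(** The kernel at the lowest level lies in the empty product, so [lam a b - b] vanishes. *)
Lemma syl_soc (j0 : 'I_n) a b : j0 = 0%N :> nat -> a \in Q (t j0) -> lam a b = b.
Proof.
move=> E0 Qa; apply/eqP; rewrite -subr_eq0 -in_set1 -rker0.
have sub0 : nker_group (level (t j0)) \subset nker_group 0.
  have -> : nker_group 0 = Qprod_group 0.
    by apply: group_inj; rewrite /= Qprod0; apply: nker0.
  by apply: nker_sub_Qprod; rewrite E0.
rewrite -mem_imlideal; apply: (subsetP sub0); rewrite /= mem_imlideal.
apply: rker_lam; rewrite -mem_imlideal; apply: (subsetP (syl_sub_nker (t j0))).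
by rewrite /= mem_imlideal.
Qed.
End Sorted.

(** * The conclusions in terms of the given addition *)

Section Conclusions.
Variable add : {perm X} -> {perm X} -> {perm X}.
Hypotheses (eT : bgroup = Gsol sig) (eD : forall a b, e (a + b) = add (e a) (e b)).

Lemma lideal_add_subgroup L : left_ideal L -> is_add_subgroup sig add (e @: L).
Proof.
move=> IL; split; first by rewrite -eT imlideal_sub.
  by rewrite -e0 imset_f ?lideal0.
by move=> _ _ /imsetP[a La ->] /imsetP[b Lb ->]; rewrite -eD imset_f ?lidealD.
Qed.

Lemma lideal_is_ideal L (IL : left_ideal L) :
  Group (imlideal_set IL) <| bgroup -> is_ideal sig add (e @: L).
Proof.
move=> nL; have E : Group (imlideal_set IL) = e @: L :> {set _} by [].
split; rewrite -?eT -?E.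
- exact: normal_sub.
- exact: group1.
- by move=> a b La Lb; apply: groupM.
- by move=> a La; rewrite groupV.
split=> [g a Gg La|_ _ /bgroupP[a ->] /imsetP[b Lb ->]].
  by rewrite /bcomp -/(conjg a g) memJ_norm // (subsetP (normal_norm nL)).
by exists (e (lam a b)); [rewrite imset_f ?lideal_lam | rewrite -eD eM].
Qed.

Lemma socleE : socle sig add = nker 1.
Proof.
apply/setP=> g; rewrite inE -eT; apply/andP/imsetP.
  case=> /bgroupP[a ->] /forallP h; exists a => //; apply/rker1P=> b.
  have /implyP/(_ (mem_bgroup b))/eqP := h (e b).
  by rewrite /bcomp -eM -eD => /e_inj/addrI.
case=> a /rker1P h ->; split; first exact: mem_bgroup.
by apply/forallP=> h'; apply/implyP=> /bgroupP[b ->]; rewrite /bcomp -eM -eD h.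
Qed.

Lemma socle_Hall : (0 < n)%N -> exists2 S : {set 'I_n}, S != set0 &
  is_add_subgroup sig add (socle sig add) /\
  pnat (primes_of_idx p S) #|socle sig add| /\
  pnat (negn (primes_of_idx p S)) (#|Gsol sig| %/ #|socle sig add|)%N.
Proof.
move=> n_gt0; have [t t_sorted] := sorting_perm level.
have [K0|K0] := posnP K.
  by have := level_lt (Ordinal n_gt0); rewrite K0.
have /and3P[sN pN iN] := nker_Hall K0.
(* Its nonemptiness comes from the prime of lowest level, whose Sylow subgroup lies in the socle. *)
exists [set i | (p i %| #|socle sig add|)%N].
  apply/set0Pn; exists (t (Ordinal n_gt0)); rewrite inE socleE.
  have : (p (t (Ordinal n_gt0)) %| #|syl_group (t (Ordinal n_gt0))|)%N.
    rewrite (card_Hall (HQ _ : _.-Hall(bgroup_group) (syl_group _))).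
    by rewrite p_part -{1}[p _]expn1 dvdn_exp2l // logn_gt0 mem_primes p_pr dvd_p_bgroup
      (cardG_gt0 bgroup_group).
  move/dvdn_trans; apply; apply: (@cardSg _ (nker_group 1) (syl_group _)).
  apply/subsetP=> _ /imsetP[a Qa ->]; rewrite /= mem_imlideal; apply/rker1P=> b.
  by apply: (syl_soc t_sorted b _ Qa).
split; first by rewrite socleE; apply/lideal_add_subgroup/rker_lideal.
rewrite socleE; split.
  apply/pnatP=> [|q q_pr qd]; first exact: (cardG_gt0 (nker_group 1)).
  have [i Eq] : exists i, q = p i.
    apply: prime_dvd_bgroup => //; apply: dvdn_trans qd _.
    exact: (cardSg (normal_sub (nker_normal 1))).
  by rewrite inE; apply/existsP; exists i; rewrite inE -Eq qd eqxx.
rewrite -eT (@divgS _ bgroup_group (nker_group 1)) //.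
apply/pnatP=> [|q q_pr qd]; first exact: (@indexg_gt0 _ bgroup_group (nker_group 1)).
rewrite inE; apply/negP=> /existsP[i /andP[]]; rewrite inE => pd /eqP Eq.
have := pnatPpi iN (_ : q \in _).
rewrite mem_primes q_pr qd (@indexg_gt0 _ bgroup_group (nker_group 1)) => /(_ isT) /negP; apply.
by apply: (pnatPpi pN); rewrite mem_primes q_pr Eq pd (cardG_gt0 (nker_group 1)).
Qed.

Lemma syl_brace i :
  {in syl i &, forall a b, bcomp a b = add a b} /\
  {in syl i, forall a, nadd add (p i) a = 1%g}.
Proof.
split=> [_ _ /imsetP[a Qa ->] /imsetP[b Qb ->]|_ /imsetP[a Qa ->]].
  by rewrite /bcomp -eM -eD (syl_trivial Qa Qb).
rewrite -e0 -(syl_elementary Qa) /nadd; elim: (p i) => [|m IH] /=.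
  by rewrite mulr0n e0.
by rewrite IH -eD mulrS.
Qed.

Lemma socle_series : exists t : 'S_n,
  [/\ forall i, (1 <= i <= n)%N -> is_ideal sig add (Qprod syl t i),
      (forall j0 : 'I_n, nat_of_ord j0 = 0%N -> syl (t j0) \subset socle sig add),
      (forall i, (1 < i <= n)%N ->
         {in Qprod syl t i & Gsol sig, forall q b,
             same_class (Qprod syl t i.-1) (bcomp q b) (add q b)}) &
      forall i, (1 <= i <= n)%N ->
        [set g in Gsol sig | [forall x, [set g y | y in hset (Qprod syl t i) x]
                                    == hset (Qprod syl t i) x]]
        = Qprod syl t i].
Proof.
have [t t_sorted] := sorting_perm level; exists t; rewrite -eT.
split=> [[//|i] /= lt|j0 E0|[//|i] /andP[_ lt] q b Qq|[//|i] /= lt].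
- have nQ := Qprod_normal t_sorted (Ordinal lt).
  have [L IL [EL _]] := Qprod_Hall t i.+1.
  have EQ : Qprod_group t i.+1 = Group (imlideal_set IL) by apply: group_inj; rewrite /= EL.
  by rewrite EL; apply: lideal_is_ideal; rewrite -EQ.
- apply/subsetP=> _ /imsetP[a Qa ->]; rewrite socleE mem_imlideal; apply/rker1P=> b.
  by apply: (syl_soc t_sorted b _ Qa).
- case/bgroupP=> c ->; have [a Ea] : exists a, q = e a.
    apply/bgroupP; apply: (subsetP (pHall_sub (Qprod_pHall t i.+1))) Qq.
  rewrite Ea in Qq *; rewrite /same_class /bcomp -eM -eD.
  exact: (Qprod_central t_sorted (j := Ordinal lt)).
apply/setP=> g; rewrite inE; set M := Qprod_group t i.+1.
have HsubM : M \subset bgroup by apply: pHall_sub (Qprod_pHall t i.+1).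
apply/andP/idP => [[Gg /forallP h]|Mg]; last first.
  split; first exact: (subsetP HsubM).
  apply/forallP=> x; apply/eqP/setP=> y; apply/imsetP/imsetP.
    case=> _ /imsetP[h Mh ->] ->; exists (h * g)%g; rewrite ?permM //.
    exact: (@groupM _ M).
  case=> h Mh ->; exists ((h * g^-1)%g x); last by rewrite permM permKV.
  by apply: imset_f; apply: (@groupM _ M) => //; rewrite (@groupV _ M).
(* Only the image of [x] itself, a point of its own orbit, is needed here. *)
apply: (mem_Qprod t_sorted (j := Ordinal lt) Gg) => x.
have /eqP E := h x; have : g x \in hset (Qprod syl t i.+1) x.
  rewrite -E; apply: imset_f; apply/imsetP; exists 1%g; rewrite ?perm1 //.
  exact: (@group1 _ M).
by case/imsetP=> q Mq ->; exists q.
Qed.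
End Conclusions.
End Main.
End Stabilizers.
End Brace.

(** * The permutation brace as an additive group *)

Section Model.
Local Open Scope ring_scope.

Lemma pact_delta (X : finType) (g : {perm X}) x : pact g (delta x) = delta (g x).
Proof. by apply/ffunP=> z; rewrite !ffunE (canF_eq (permKV g)). Qed.

Lemma sum_delta (X : finType) (c : {ffun X -> int}) : c = \sum_x delta x *~ c x.
Proof.
apply/ffunP=> z; rewrite sum_ffunE (bigD1 z) //= ffunMzE ffunE eqxx intz.
by rewrite big1 ?addr0 // => x nx; rewrite ffunMzE ffunE eq_sym (negPf nx) mul0rz.
Qed.

(** [A] is the permutation group with [add] as addition, and [lam a b] is a o b - a. The map [f]
    from Z^X becomes a surjective homomorphism [F], through which the statements about [s] are
    checked on basis vectors. *)
Lemma Gbrace_model (X : finType) (sig : X -> {perm X}) add : is_Gbrace sig add ->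
  exists (A : finZmodType) (e : A -> {perm X}) (lam : A -> A -> A) (s : X -> A),
    [/\ injective e /\ e @: setT = Gsol sig,
        forall a b, e (a + b) = add (e a) (e b),
        forall a b, e (a + lam a b) = (e b * e a)%g,
        forall a b c, lam a (b + c) = lam a b + lam a c &
        [/\ forall x, e (s x) = sig x,
            forall a x, lam a (s x) = s (e a x) &
            forall L : {set A}, 0 \in L -> {in L &, forall a b, a + b \in L} ->
              (forall x, s x \in L) -> forall a, a \in L]].
Proof.
case=> -[addG addGA addGC add1G addGN] distr [f [fG fD fs fM]].
set G := Gsol sig in addG addGA addGC add1G addGN distr fG *.
pose T := {g : {perm X} | g \in G}.
have G1 : 1%g \in G by rewrite group1.
pose z : T := exist _ 1%g G1.
pose ad (a b : T) : T := exist _ (add (val a) (val b)) (addG _ _ (valP a) (valP b)).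
have ex_opp (a : T) : exists b, (b \in G) && (add (val a) b == 1%g).
  by have [b Gb Eb] := addGN _ (valP a); exists b; rewrite Gb Eb /=.
have opp_subproof a : xchoose (ex_opp a) \in G by case/andP: (xchooseP (ex_opp a)).
pose opp (a : T) : T := exist (fun g => g \in G) _ (opp_subproof a).
have adA : associative ad.
  by move=> a b c; apply: val_inj; rewrite /= addGA ?(valP a) ?(valP b) ?(valP c).
have adC : commutative ad.
  by move=> a b; apply: val_inj; rewrite /= addGC ?(valP a) ?(valP b).
have ad0 : left_id z ad by move=> a; apply: val_inj; rewrite /= add1G ?(valP a).
have adN : left_inverse z opp ad.
  move=> a; rewrite adC; apply: val_inj => /=.
  by case/andP: (xchooseP (ex_opp a)) => _ /eqP.
pose A : finZmodType := HB.pack T (GRing.isZmodule.Build T adA adC ad0 adN).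
pose e (a : A) : {perm X} := val (a : T).
have eD (a b : A) : e (a + b) = add (e a) (e b) by [].
have e_inj : injective e := val_inj.
have eG (a : A) : e a \in G := valP (a : T).
pose circ (a b : A) : A := exist _ (e b * e a)%g (groupM (eG b) (eG a)).
pose lam (a b : A) : A := circ a b - a.
have sG x : sig x \in G by apply/mem_gen/imset_f.
pose s x : A := exist (fun g => g \in G) (sig x) (sG x).
have lamE a b : a + lam a b = circ a b by rewrite addrC subrK.
pose F (c : {ffun X -> int}) : A := exist _ (f c) (fG c).
have FD c d : F (c + d) = F c + F d by apply: e_inj; rewrite eD; apply: fD.
have FM c d : F (c + pact (f c) d) = circ (F c) (F d) by apply: e_inj; apply: fM.
have F0 : F 0 = 0 by apply: (addrI (F 0)); rewrite -FD !addr0.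
have FN c : F (- c) = - F c by apply: (addrI (F c)); rewrite -FD !subrr F0.
have Fs x : F (delta x) = s x by apply: e_inj; apply: fs.
have F_surj a : exists c, F c = a.
  suff: exists c, f c = e a by case=> c Ec; exists c; apply: e_inj.
  have /gen_prodgP[m [c Sc ->]] := eG a.
  apply: (big_ind (fun g => exists c, f c = g)) => [|_ _ [c1 <-] [c2 <-]|i _].
  - by exists 0; have /(congr1 e) := F0.
  (* The order is exchanged because [bcomp] reverses the product of permutations. *)
  - by exists (c2 + pact (f c2) c1); rewrite fM.
  by have /imsetP[x _ ->] := Sc i; exists (delta x).
exists A, e, lam, s; split=> //.
- split=> //; apply/setP=> g; apply/imsetP/idP => [[a _ ->]|Gg]; first exact: eG.
  by exists (exist _ g Gg : A).
- by move=> a b; rewrite lamE.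
- move=> a b c.
  have D : circ a (b + c) + a = circ a b + circ a c.
    by apply: e_inj; rewrite !eD; apply: distr; apply: eG.
  by rewrite /lam addrACA -D addrA addrK.
split=> // [a x|L L0 LD Ls a].
  have [c <-] := F_surj a; apply: (addrI (F c)).
  by rewrite lamE -!Fs -FM FD pact_delta.
have gL : group_set L by apply/group_setP.
have LN b : b \in L -> - b \in L by apply: (@groupVr _ (Group gL)).
have [c <-] := F_surj a; rewrite (sum_delta c).
apply: (big_ind (fun c => F c \in L)) => [|c1 c2 h1 h2|x _]; first by rewrite F0.
  by rewrite FD LD.
have Ln m : F (delta x *+ m) \in L.
  by elim: m => [|m IH]; rewrite ?mulr0n ?F0 // mulrS FD Fs LD.
by case: (c x) => m; rewrite ?NegzE ?mulrNz -pmulrn ?FN ?LN ?Ln.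
Qed.
End Model.

Theorem theorem4p1 (n : nat) (p : 'I_n -> nat) (X : finType)
  (sig gam : X -> {perm X}) (add : {perm X} -> {perm X} -> {perm X})
  (P : 'I_n -> {set {perm X}}) :
  (0 < n)%N ->
  (forall i, prime (p i)) -> injective p ->
  is_solution sig gam -> indecomposable sig -> multipermutation sig ->
  #|X| = (\prod_(i < n) p i)%N ->
  is_Gbrace sig add ->
  (forall i, is_add_sylow sig add (p i) (P i)) ->
  let G := Gsol sig in
  let soc := socle sig add in
  [/\ (* (i) *)
      exists2 S : {set 'I_n}, S != set0 &
        is_add_subgroup sig add soc /\
        pnat (primes_of_idx p S) #|soc| /\ pnat (negn (primes_of_idx p S)) (#|G| %/ #|soc|),
      (* (ii) *)
      G = \big[@setcomp X/[set 1%g]]_(j < n) P j /\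
        (forall q, prime q -> (q %| #|G|)%N -> exists i, q = p i),
      (* (iii) *)
      (forall i, {in P i &, forall a b, bcomp a b = add a b} /\
                 {in P i, forall a, nadd add (p i) a = 1%g}) &
      (* (iv) and (v) *)
      exists s : 'S_n,
        [/\ forall i, (1 <= i <= n)%N -> is_ideal sig add (Qprod P s i),
            (forall j0 : 'I_n, nat_of_ord j0 = 0%N -> P (s j0) \subset soc),
            (forall i, (1 < i <= n)%N ->
               {in Qprod P s i & G, forall q b,
                   same_class (Qprod P s i.-1) (bcomp q b) (add q b)}) &
            forall i, (1 <= i <= n)%N ->
              [set g in G | [forall x, [set g y | y in hset (Qprod P s i) x]
                                         == hset (Qprod P s i) x]]
              = Qprod P s i]].
Proof.
move=> n_gt0 p_pr p_inj _ indec [K [_ retK]] cX brace sylP G soc.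
have [A [e [lam [s [[e_inj eT] eD eM lamD [e_s lam_s s_gen]]]]]] := Gbrace_model brace.
have cA : #|A| = #|Gsol sig| by rewrite -eT card_imset // cardsT.
pose Q i := e @^-1: P i.
have PE i : P i = syl e Q i.
  have [[sPG _ _] _] := sylP i; apply/setP=> g; apply/idP/imsetP => [Pg|[a]].
    have: g \in Gsol sig by apply: (subsetP sPG).
    by rewrite -eT => /imsetP[a _ Eg]; exists a; rewrite // inE -Eg.
  by rewrite inE => Pa ->.
have cP i : #|Q i| = (#|A|`_(p i))%N.
  by have [_ cPi] := sylP i; rewrite cA -cPi PE card_imset.
have IQ i : left_ideal lam (Q i).
  have [[_ P1 PD] _] := sylP i; apply: (lideal_Sylow lamD _ _ (cP i)).
    by rewrite inE (e0 eM lamD).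
  by move=> a b; rewrite !inE eD; apply: PD.
(* A left ideal is also a multiplicative subgroup, so an additive Sylow subgroup is a multiplicative
   one by its order. *)
have HQ i : (p i).-Hall(bgroup e)%g (e @: Q i).
  rewrite (pHallE _ (bgroup_group eM lamD) (Group (imlideal_set e_inj eM lamD (IQ i)))).
  by rewrite imlideal_sub /= card_imset // cP /bgroup eT cA.
have /card_gt0P[x0 _] : (0 < #|X|)%N by rewrite cX prodn_gt0 // => i; apply: prime_gt0.
have trans x : exists a, e a x0 = x.
  have [g] := indec x0 x; rewrite -eT => /imsetP[a _ ->] <-; by exists a.
have sqfX m m' : (m * m')%N = #|X| -> coprime m m'.
  by rewrite cX; apply: coprime_of_mul_prod_primes.
have QE t i : Qprod P t i = Qprod (syl e Q) t i by apply: eq_bigr => j _; rewrite PE.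
have SH := socle_Hall e_inj eM lamD e_s lam_s s_gen trans retK sqfX p_pr cX IQ HQ eT eD n_gt0.
have pG := prime_dvd_bgroup e_inj eM lamD e_s lam_s s_gen trans retK sqfX p_pr cX.
have GE := bigsyl_all e_inj eM lamD e_s lam_s s_gen trans retK sqfX p_pr cX IQ HQ.
have tr := syl_brace e_inj eM lamD e_s lam_s s_gen trans retK sqfX p_pr cX IQ HQ eD.
have [t [h1 h2 h3 h4]] :=
  socle_series e_inj eM lamD e_s lam_s s_gen trans retK sqfX p_pr cX IQ HQ eT eD.
split=> //.
- rewrite /G -eT; split; last exact: pG.
  by rewrite -[LHS]GE; apply: eq_bigr => i _; rewrite PE.
- by move=> i; rewrite PE; apply: tr.
exists t; split=> [i lt|j0 E0|i lt|i lt]; rewrite ?QE ?PE.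
- exact: h1.
- exact: h2.
- exact: h3.
exact: h4.
Qed.
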